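(* Let $g$ be a metric field on $U$ and let $h$ be a gauge metric field for $g$, so that $g=h^\dagger\circ\eta\circ h$ with $\eta$ an orthogonal metric field of the same signature as $g$. For any $g$-compatible pair of $a$-DCDO's $({}_{g}\mathcal{D}_{a}^{+},{}_{g}\mathcal{D}_{a}^{-})$ there exists a unique $\eta$-compatible pair of $a$-DCDO's $({}_{\eta}\mathcal{D}_{a}^{+},{}_{\eta}\mathcal{D}_{a}^{-})$ such that, for all $X\in\mathcal{M}(U)$, $$\underline{h}({}_{g}\mathcal{D}_{a}^{+}X)={}_{\eta}\mathcal{D}_{a}^{+}\,\underline{h}(X),\qquad \underline{h}^{*}({}_{g}\mathcal{D}_{a}^{-}X)={}_{\eta}\mathcal{D}_{a}^{-}\,\underline{h}^{*}(X).$$ Reciprocally, given any $\eta$-compatible pair of $a$-DCDO's $({}_{\eta}\mathcal{D}_{a}^{+},{}_{\eta}\mathcal{D}_{a}^{-})$, there is a unique $g$-compatible pair of $a$-DCDO's $({}_{g}\mathcal{D}_{a}^{+},{}_{g}\mathcal{D}_{a}^{-})$ such that these two formulas are satisfied for all $X\in\mathcal{M}(U)$.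
   Context: Setting: $M$ is a smooth $n$-dimensional manifold, $U_o\subseteq M$ is the domain of a fixed chart with coordinates $x^1,\dots,x^n$, and $U\subseteq U_o$ is open. $\mathcal{U}_o$ is the (fixed) $n$-dimensional real vector space spanned by the coordinate basis $b_1,\dots,b_n$, with the Euclidean scalar product $\cdot$ for which $b_i\cdot b_j=\delta_{ij}$. $\bigwedge\mathcal{U}_o$ is its exterior algebra (multivectors), with the induced scalar product $(v_1\wedge\dots\wedge v_k)\cdot(w_1\wedge\dots\wedge w_k)=\det(v_i\cdot w_j)$, different grades being orthogonal. For a vector $v$, $v\lrcorner$ is the usual left contraction: the antiderivation of $\bigwedge\mathcal{U}_o$ vanishing on scalars with $v\lrcorner w=v\cdot w$ on vectors. $\mathcal{V}(U)$ and $\mathcal{M}(U)$ denote the smooth functions on $U$ with values in $\mathcal{U}_o$ and $\bigwedge\mathcal{U}_o$ (smooth vector and multivector fields). For $a=a^ib_i\in\mathcal{V}(U)$, $a\cdot\partial_o=a^i\,\partial/\partial x^i$ acts on such fields componentwise with respect to the fixed (constant) basis. A smooth $(1,1)$-extensor field on $U$ is a smooth assignment $x\mapsto t_{(x)}$ of a linear map $t_{(x)}:\mathcal{U}_o\to\mathcal{U}_o$, $x\in U$, acting on vector fields pointwise; it is non-singular if each $t_{(x)}$ is invertible. $t^\dagger$ is the adjoint with respect to $\cdot$, and $t^*=(t^{-1})^\dagger=(t^\dagger)^{-1}$. The extended $\underline t$ of $t$ is the exterior algebra endomorphism with $\underline t(\alpha)=\alpha$ for scalars and $\underline t(v_1\wedge\dots\wedge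 v_k)=t(v_1)\wedge\dots\wedge t(v_k)$; $\underline h^{*}$ is the extended of $h^*$. The generalized $T$ of $t$ is $T(X)=\sum_i t(b_i)\wedge(b_i\lrcorner X)$, i.e. the derivation of $\bigwedge\mathcal{U}_o$ vanishing on scalars and extending $t$. A metric field on $U$ is a smooth $(1,1)$-extensor field $g$ on $U$ with $g_{(p)}=g_{(p)}^\dagger$ and $\det g_{(p)}\ne0$ for each $p\in U$. An orthogonal metric field is a metric field $\eta$ each of whose values is an orthogonal map, i.e. $\eta^\dagger=\eta^{-1}$ (so $\eta=\eta^\dagger=\eta^{-1}$). A gauge metric field for $g$ is a non-singular smooth $(1,1)$-extensor field $h$ on $U$ such that $g=h^\dagger\circ\eta\circ h$, where $\eta$ is an orthogonal metric field with the same signature as $g$. A connection field $\gamma$ on $U$ is a smooth assignment to each $x\in U$ of a bilinear map $\gamma_{(x)}:\mathcal{U}_o\times\mathcal{U}_o\to\mathcal{U}_o$; for $a\in\mathcal{V}(U)$ put $\gamma_a(b)=\gamma(a,b)$ and let $\Gamma_a$ be the generalized of $\gamma_a$. The pair of $a$-DCDO's ($a$-directional covariant derivative operators) associated to $(U,\gamma)$ is $(\nabla_a^+,\nabla_a^-)$, $\nabla_a^\pm:\mathcal{M}(U)\to\mathcal{M}(U)$, $$\nabla_a^+X=a\cdot\partial_oX+\Gamma_a(X),\qquad \nabla_a^-X=a\cdot\partial_oX-\Gamma_a^\dagger(X),$$ with $a$ ranging over $\mathcal{V}(U)$. A ''pair of $a$-DCDO's'' means such a pair for some connection field on $U$. For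 a metric field $k$ on $U$, the pair is called $k$-compatible if $\nabla_a^{++}k=0$ for all $a\in\mathcal{V}(U)$, where $(\nabla_a^{++}k)(b)=\nabla_a^-(k(b))-k(\nabla_a^+b)$ for $b\in\mathcal{V}(U)$. *)

(* Defs.v *)
From HB Require Import structures.
From mathcomp Require Import all_boot all_order all_algebra.
From mathcomp Require Import all_classical all_reals all_analysis.

Set Implicit Arguments.
Unset Strict Implicit.
Unset Printing Implicit Defensive.

Import Order.TTheory GRing.Theory Num.Theory.
Import numFieldNormedType.Exports.

Local Open Scope classical_set_scope.
Local Open Scope ring_scope.

(* A homeomorphism from an open subset of M onto an open subset of R^n.  The
   values of chart_map outside chart_dom are irrelevant. *)
Record chart (R : realType) (n : nat) (M : topologicalType) := Chart {
  chart_dom : set M;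
  chart_map :> M -> 'rV[R]_n;
  chart_dom_open : open chart_dom;
  chart_inj : {in chart_dom &, injective chart_map};
  chart_continuous : {within chart_dom, continuous chart_map};
  chart_open_map : forall V : set M,
    V `<=` chart_dom -> open V -> open (chart_map @` V) }.

Record chart_open (R : realType) (n : nat) (M : topologicalType)
    (phi : chart R n M) := ChartOpen {
  chart_open_set :> set M;
  chart_openP : open chart_open_set;
  chart_open_sub : chart_open_set `<=` chart_dom phi }.

Section Smooth.
Context {R : realType} {n : nat} {M : topologicalType} {phi : chart R n M}.
Variable U : chart_open phi.
Implicit Types f : U -> R.

(* f o phi^-1, extended by 0 outside the open set phi(U). *)
Definition coord_expr f (y : 'rV[R]_n) : R :=
  if pselect (exists p : U, phi (val p) = y) is left H
  then f (projT1 (cid H)) else 0.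

Definition partial (i : 'I_n) f : U -> R :=
  fun p => 'D_(delta_mx 0 i) (coord_expr f) (phi (val p)).

(* Class C^k on the open set phi(U), by continuity of the iterated partial
   derivatives up to order k in the coordinates of phi. *)
Fixpoint Ck (k : nat) f : Prop :=
  (forall p : U, {for phi (val p), continuous (coord_expr f)}) /\
  if k is k'.+1 then
    forall i : 'I_n,
      (forall p : U, derivable (coord_expr f) (phi (val p)) (delta_mx 0 i)) /\
      Ck k' (partial i f)
  else True.

Definition smooth f := forall k, Ck k f.

Lemma coord_exprE f (p : U) : coord_expr f (phi (val p)) = f p.
Proof.
rewrite /coord_expr; case: pselect => [H|[]]; last by exists p.
congr f; apply: val_inj; case: (cid H) => q /= hq.
by apply: (@chart_inj _ _ _ phi) => //; rewrite inE;
  apply: (@chart_open_sub _ _ _ _ U); apply: set_mem; apply: valP.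
Qed.

Lemma coord_expr_near f (F : 'rV[R]_n -> R) (p : U) :
  (forall q : U, F (phi (val q)) = f q) ->
  \forall y \near phi (val p), coord_expr f y = F y.
Proof.
move=> fF.
have oU : open (phi @` U).
  by apply: chart_open_map; [exact: chart_open_sub|exact: chart_openP].
have pU : (phi @` U) (phi (val p)) by exists (val p) => //; apply: set_mem; apply: valP.
have := open_nbhs_nbhs (conj oU pU); apply: filterS => y [x Ux <-].
have xU : x \in (U : set M) by rewrite inE.
by rewrite -[x]/(val (exist _ x xU : U)) coord_exprE fF.
Qed.

Lemma Ck_continuous k f : Ck k f ->
  forall p : U, {for phi (val p), continuous (coord_expr f)}.
Proof. by case: k => [|k] []. Qed.

Lemma CkS k f : Ck k.+1 f -> Ck k f.
Proof.
elim: k f => [|k IH] f [fc fd]; first by split.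
by split=> // i; have [fdi /IH] := fd i.
Qed.

Lemma coord_expr0 : coord_expr (fun=> 0) = cst 0.
Proof. by apply/funext => y; rewrite /coord_expr; case: pselect. Qed.

Lemma coord_exprD f g :
  coord_expr (fun p => f p + g p) = coord_expr f + coord_expr g.
Proof.
by apply/funext => y; rewrite fctE /coord_expr; case: pselect; rewrite ?addr0.
Qed.

Lemma coord_exprM f g :
  coord_expr (fun p => f p * g p) = coord_expr f * coord_expr g.
Proof.
by apply/funext => y; rewrite fctE /coord_expr; case: pselect; rewrite ?mulr0.
Qed.

Lemma coord_exprV f :
  coord_expr (fun p => (f p)^-1) = (fun y => (coord_expr f y)^-1).
Proof.
by apply/funext => y; rewrite /coord_expr; case: pselect; rewrite ?invr0.
Qed.

Lemma Ck_cst k (c : R) : Ck k (fun=> c).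
Proof.
elim: k c => [|k IH] c.
  split=> // p; have h : \forall y \near phi (val p),
      coord_expr (fun _ : U => c) y = coord_expr (fun _ : U => c) (phi (val p)).
    have := @coord_expr_near (fun=> c) (cst c) p (fun=> erefl).
    by apply: filterS => y ->; rewrite (coord_exprE (fun=> c)).
  exact: cvg_near_cst h.
have nc p := @coord_expr_near (fun=> c) (cst c) p (fun=> erefl).
split; first exact: (Ck_continuous (IH c)).
move=> i; split.
  move=> p; apply: (near_eq_derivable (f := cst c)); last exact: derivable_cst.
  by apply: filterS (nc p) => y ->.
rewrite (_ : partial i _ = fun=> 0); first exact: IH.
apply/funext => p; rewrite /partial (near_eq_derive _ (nc p)).
exact: derive_cst.
Qed.

Lemma CkD k f g : Ck k f -> Ck k g -> Ck k (fun p => f p + g p).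
Proof.
elim: k f g => [|k IH] f g fk gk.
  split=> // p; rewrite coord_exprD.
  by apply: continuousD; [exact: (Ck_continuous fk)|exact: (Ck_continuous gk)].
split.
  move=> p; rewrite coord_exprD.
  by apply: continuousD; [exact: (Ck_continuous fk)|exact: (Ck_continuous gk)].
move=> i; have [fd f'] := fk.2 i; have [gd g'] := gk.2 i; split.
  by move=> p; rewrite coord_exprD; apply: derivableD.
rewrite (_ : partial i _ = fun p => partial i f p + partial i g p).
  exact: IH.
by apply/funext => p; rewrite /partial coord_exprD deriveD.
Qed.

Lemma partialM i f g (p : U) :
  derivable (coord_expr f) (phi (val p)) (delta_mx 0 i) ->
  derivable (coord_expr g) (phi (val p)) (delta_mx 0 i) ->
  partial i (fun q => f q * g q) p = f p * partial i g p + g p * partial i f p.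
Proof.
by move=> fd gd; rewrite /partial coord_exprM deriveM // !coord_exprE.
Qed.

Lemma CkM k f g : Ck k f -> Ck k g -> Ck k (fun p => f p * g p).
Proof.
elim: k f g => [|k IH] f g fk gk.
  split=> // p; rewrite coord_exprM.
  by apply: continuousM; [exact: (Ck_continuous fk)|exact: (Ck_continuous gk)].
split.
  move=> p; rewrite coord_exprM.
  by apply: continuousM; [exact: (Ck_continuous fk)|exact: (Ck_continuous gk)].
move=> i; have [fd f'] := fk.2 i; have [gd g'] := gk.2 i; split.
  by move=> p; rewrite coord_exprM; apply: derivableM.
rewrite (_ : partial i _ = fun p => f p * partial i g p + g p * partial i f p).
  by apply: CkD; apply: IH => //; apply: CkS.
by apply/funext => p; rewrite partialM.
Qed.

Lemma CkV k f : (forall p, f p != 0) -> Ck k f -> Ck k (fun p => (f p)^-1).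
Proof.
move=> f0; have cV (p : U) : {for phi (val p), continuous (coord_expr f)} ->
    {for phi (val p), continuous (coord_expr (fun q => (f q)^-1))}.
  have fp0 : coord_expr f (phi (val p)) != 0 by rewrite coord_exprE.
  by move=> fc; rewrite coord_exprV; exact: (continuousV fp0 fc).
elim: k f f0 cV => [|k IH] f f0 cV fk.
  by split=> // p; apply: cV; apply: (Ck_continuous fk).
split; first by move=> p; apply: cV; apply: (Ck_continuous fk).
move=> i; have [fd f'] := fk.2 i; split.
  by move=> p; rewrite coord_exprV; apply: derivableV; rewrite ?coord_exprE.
rewrite (_ : partial i _ =
    fun p => (-1 * partial i f p) * ((f p)^-1 * (f p)^-1)).
  have fVk : Ck k (fun p => (f p)^-1) by apply: IH => //; apply: CkS.
  by apply: CkM; apply: CkM => //; apply: Ck_cst.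
apply/funext => p; rewrite /partial coord_exprV deriveV ?coord_exprE //.
by rewrite -exprVn expr2 mulN1r scaleNr mulNr; congr (- _); apply: mulrC.
Qed.

Lemma smooth_cst (c : R) : smooth (fun=> c).
Proof. by move=> k; apply: Ck_cst. Qed.

Lemma smooth_ext f g : (forall p, f p = g p) -> smooth g -> smooth f.
Proof. by move=> /funext ->. Qed.

Lemma smoothD f g : smooth f -> smooth g -> smooth (fun p => f p + g p).
Proof. by move=> fs gs k; apply: CkD. Qed.

Lemma smoothM f g : smooth f -> smooth g -> smooth (fun p => f p * g p).
Proof. by move=> fs gs k; apply: CkM. Qed.

Lemma smoothV f : (forall p, f p != 0) -> smooth f ->
  smooth (fun p => (f p)^-1).
Proof. by move=> f0 fs k; apply: CkV. Qed.

Lemma smooth_partial i f : smooth f -> smooth (partial i f).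
Proof. by move=> fs k; have [_ /(_ i) []] := fs k.+1. Qed.

Lemma smooth_sum (I : Type) (r : seq I) (P : pred I) (F : I -> U -> R) :
  (forall i, P i -> smooth (F i)) -> smooth (fun p => \sum_(i <- r | P i) F i p).
Proof.
move=> Fs; elim: r => [|i r IH].
  rewrite (_ : (fun p => _) = fun=> 0); first exact: smooth_cst.
  by apply/funext => p; rewrite big_nil.
have [Pi|nPi] := boolP (P i); last first.
  by rewrite (_ : (fun p => _) = fun p => \sum_(j <- r | P j) F j p) //;
    apply/funext => p; rewrite big_cons (negPf nPi).
rewrite (_ : (fun p => _) = fun p => F i p + \sum_(j <- r | P j) F j p).
  by apply: smoothD => //; apply: Fs.
by apply/funext => p; rewrite big_cons Pi.
Qed.

Lemma smooth_prod (I : Type) (r : seq I) (P : pred I) (F : I -> U -> R) :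
  (forall i, P i -> smooth (F i)) ->
  smooth (fun p => \prod_(i <- r | P i) F i p).
Proof.
move=> Fs; elim: r => [|i r IH].
  rewrite (_ : (fun p => _) = fun=> 1); first exact: smooth_cst.
  by apply/funext => p; rewrite big_nil.
have [Pi|nPi] := boolP (P i); last first.
  by rewrite (_ : (fun p => _) = fun p => \prod_(j <- r | P j) F j p) //;
    apply/funext => p; rewrite big_cons (negPf nPi).
rewrite (_ : (fun p => _) = fun p => F i p * \prod_(j <- r | P j) F j p).
  by apply: smoothM => //; apply: Fs.
by apply/funext => p; rewrite big_cons Pi.
Qed.

Lemma smooth_det m (t : U -> 'M[R]_m) :
  (forall i j, smooth (fun p => t p i j)) -> smooth (fun p => \det (t p)).
Proof.
move=> ts; apply: smooth_sum => s _; apply: smoothM; first exact: smooth_cst.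
by apply: smooth_prod => i _.
Qed.

Lemma smooth_invmx m (t : U -> 'M[R]_m) :
  (forall p, t p \in unitmx) ->
  (forall i j, smooth (fun p => t p i j)) ->
  forall i j, smooth (fun p => invmx (t p) i j).
Proof.
move=> tu ts i j.
rewrite (_ : (fun p => _) = fun p => (\det (t p))^-1 * cofactor (t p) j i).
  apply: smoothM.
    by apply: smoothV; [move=> p; have := tu p; rewrite unitmxE unitfE|exact: smooth_det].
  apply: smoothM; first exact: smooth_cst.
  apply: smooth_det => i' j'.
  by rewrite (_ : (fun p => _) = fun p => t p (lift j i') (lift i j')) //;
    apply/funext => p; rewrite !mxE.
by apply/funext => p; rewrite /invmx tu !mxE.
Qed.

End Smooth.

(* vec R n is the space spanned by the coordinate basis (the standard basis
   bvec, orthonormal for the scalar product v^T *m w); linear maps of it are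
   matrices acting by A *m v, so that the adjoint is the transpose.
   mvec R n is its exterior algebra: X S is the coordinate of X on the blade
   b_{i1} /\ ... /\ b_{ik}, where S = {i1 < ... < ik} (see bladeE). *)
Notation vec R n := 'cV[R]_n.
Notation mvec R n := {ffun {set 'I_n} -> R^o}.

Section ExteriorAlgebra.
Local Open Scope set_scope.
Local Open Scope ring_scope.
Context {R : realType} {n : nat}.
Implicit Types (v w : vec R n) (X Y : mvec R n) (S T : {set 'I_n}).
Implicit Types t : vec R n -> vec R n.

Definition bvec (i : 'I_n) : vec R n := delta_mx i 0.

Definition blade S : mvec R n := [ffun T : {set 'I_n} => (T == S)%:R].

Definition mscal (c : R) : mvec R n := c *: blade finset.set0.

(* The inclusion of vectors in multivectors, and the grade 1 coordinates. *)
Definition mvect v : mvec R n := \sum_i v i 0 *: blade [set i].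

Definition vpart X : vec R n := \col_i X [set i].

(* b_A /\ b_B = (-1)^(inversions A B) b_{A u B} when A and B are disjoint,
   and 0 otherwise. *)
Definition inversions S T : nat :=
  #|[set p : 'I_n * 'I_n | [&& p.1 \in S, p.2 \in T & (p.2 < p.1)%N]]|.

Definition wedge X Y : mvec R n :=
  [ffun S : {set 'I_n} => \sum_(A : {set 'I_n} | A \subset S)
     (-1) ^+ inversions A (S :\: A) * (X A * Y (S :\: A))].

(* b_i contracted with b_S is (-1)^#{j in S | j < i} b_{S \ i} if i is in S,
   and 0 otherwise; the antiderivation rule is lcontr_wedge. *)
Definition lcontr v X : mvec R n :=
  [ffun S : {set 'I_n} => \sum_(i | i \notin S)
     (-1) ^+ inversions [set i] S * (v i 0 * X (i |: S))].

(* The blades are orthonormal for the induced scalar product; the determinant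
   formula and the orthogonality of distinct grades are mdot_wedgef and
   mdot_wedges_grade. *)
Definition mdot X Y : R := \sum_S X S * Y S.

(* The adjoint for mdot of a linear F, see madjointP. *)
Definition madjoint (F : mvec R n -> mvec R n) Y : mvec R n :=
  [ffun S : {set 'I_n} => mdot (F (blade S)) Y].

Definition wedges (vs : seq (vec R n)) : mvec R n :=
  foldr (fun v X => wedge (mvect v) X) (mscal 1) vs.

(* Both are given on the blades; see extended_wedge and generalized_wedge for
   the morphism and the derivation properties. *)
Definition extended_of t X : mvec R n :=
  \sum_S X S *: wedges [seq t (bvec i) | i <- enum S].

Definition generalized_of t X : mvec R n :=
  \sum_i wedge (mvect (t (bvec i))) (lcontr (bvec i) X).

End ExteriorAlgebra.

Section Signature.
Context {R : realType} {n : nat}.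
Implicit Types A B : 'M[R]_n.

(* The numbers of positive and of negative eigenvalues, with multiplicity. *)
Definition has_signature A (pq : nat * nat) : Prop :=
  exists2 s : seq R, char_poly A = \prod_(x <- s) ('X - x%:P) &
    pq = (count (fun x => 0 < x) s, count (fun x => x < 0) s).

Definition same_signature A B : Prop :=
  exists2 pq, has_signature A pq & has_signature B pq.

End Signature.

Section Manifold.
Context {R : realType} {n : nat} {M : topologicalType}.
Implicit Types phi psi : chart R n M.

(* dom phi n dom psi, seen in the chart psi. *)
Definition chart_overlap phi psi : chart_open psi :=
  ChartOpen (openI (chart_dom_open phi) (chart_dom_open psi))
            (@subIsetr _ (chart_dom phi) (chart_dom psi)).

(* The transition map phi o psi^-1 is smooth. *)
Definition smoothly_related phi psi : Prop :=
  forall i, smooth (fun p : chart_overlap phi psi => phi (val p) 0 i).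

Record smooth_atlas (A : set (chart R n M)) : Prop := SmoothAtlas {
  atlas_cover : \bigcup_(phi in A) chart_dom phi = [set: M];
  atlas_smooth : forall phi psi, A phi -> A psi -> smoothly_related phi psi }.

Record smooth_manifold (A : set (chart R n M)) : Prop := SmoothManifold {
  manifold_hausdorff : hausdorff_space M;
  manifold_second_countable : @second_countable M;
  manifold_atlas : smooth_atlas A }.

End Manifold.

Section Fields.
Context {R : realType} {n : nat} {M : topologicalType} {phi : chart R n M}.
Variable U : chart_open phi.

(* Fields on U have the subtype of the points of U as domain. *)
Record vfield := VField {
  vfield_val :> U -> vec R n;
  vfield_smooth : forall i, smooth (fun p => vfield_val p i 0) }.

Record mvfield := MVField {
  mvfield_val :> U -> mvec R n;
  mvfield_smooth : forall S, smooth (fun p => mvfield_val p S) }.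

Record extfield := ExtField {
  extfield_val :> U -> 'M[R]_n;
  extfield_smooth : forall i j, smooth (fun p => extfield_val p i j) }.

Record connection := Connection {
  conn_val :> U -> vec R n -> vec R n -> vec R n;
  conn_bilinear : forall p, bilinear_for *:%R *:%R (conn_val p);
  conn_smooth : forall i j k,
    smooth (fun p => conn_val p (bvec i) (bvec j) k 0) }.

End Fields.

Section SmoothMultivectors.
Local Open Scope set_scope.
Local Open Scope ring_scope.
Context {R : realType} {n : nat} {M : topologicalType} {phi : chart R n M}.
Variable U : chart_open phi.
Implicit Types F G : U -> mvec R n.

Definition msmooth F := forall S, smooth (fun p => F p S).

Lemma msmooth_cst (X : mvec R n) : msmooth (fun=> X).
Proof. by move=> S; apply: smooth_cst. Qed.

Lemma msmoothZ (c : U -> R) F :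
  smooth c -> msmooth F -> msmooth (fun p => c p *: F p).
Proof.
move=> cs Fs S; apply: (@smooth_ext _ _ _ _ _ _ (fun p => c p * F p S)).
  by move=> p; rewrite ffunE.
exact: smoothM.
Qed.

Lemma msmooth_sum (I : Type) (r : seq I) (F : I -> U -> mvec R n) :
  (forall i, msmooth (F i)) -> msmooth (fun p => \sum_(i <- r) F i p).
Proof.
move=> Fs S; apply: (@smooth_ext _ _ _ _ _ _ (fun p => \sum_(i <- r) F i p S)).
  by move=> p; rewrite sum_ffunE.
by apply: smooth_sum => i _; apply: Fs.
Qed.

Lemma msmooth_wedge F G :
  msmooth F -> msmooth G -> msmooth (fun p => wedge (F p) (G p)).
Proof.
move=> Fs Gs S; apply: (@smooth_ext _ _ _ _ _ _ (fun p =>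
  \sum_(A : {set 'I_n} | A \subset S)
    (-1) ^+ inversions A (S :\: A) * (F p A * G p (S :\: A)))).
  by move=> p; rewrite ffunE.
apply: smooth_sum => A _; apply: smoothM; first exact: smooth_cst.
exact: smoothM.
Qed.

Lemma msmooth_mvect (v : U -> vec R n) :
  (forall i, smooth (fun p => v p i 0)) -> msmooth (fun p => mvect (v p)).
Proof.
by move=> vs; apply: msmooth_sum => i; apply: msmoothZ => //; apply: msmooth_cst.
Qed.

Lemma smooth_mulmx m k l (s : U -> 'M[R]_(m, k)) (t : U -> 'M[R]_(k, l)) :
  (forall i j, smooth (fun p => s p i j)) ->
  (forall i j, smooth (fun p => t p i j)) ->
  forall i j, smooth (fun p => (s p *m t p) i j).
Proof.
move=> ss ts i j.
apply: (@smooth_ext _ _ _ _ _ _ (fun p => \sum_h s p i h * t p h j)).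
  by move=> p; rewrite mxE.
by apply: smooth_sum => h _; apply: smoothM.
Qed.

Lemma msmooth_extended (t : U -> 'M[R]_n) F :
  (forall i j, smooth (fun p => t p i j)) -> msmooth F ->
  msmooth (fun p => extended_of (mulmx (t p)) (F p)).
Proof.
move=> ts Fs; apply: msmooth_sum => S; apply: msmoothZ; first exact: Fs.
elim: (enum S) => [|i r IH] /=; first exact: msmooth_cst.
apply: msmooth_wedge => //; apply: msmooth_mvect => j.
by apply: smooth_mulmx => // k l; apply: smooth_cst.
Qed.

End SmoothMultivectors.

Section Operators.
Context {R : realType} {n : nat} {M : topologicalType} {phi : chart R n M}.
Variable U : chart_open phi.
Implicit Types (t k g h eta : extfield U) (a b : vfield U) (X : mvfield U).

Definition mvect_field b : mvfield U :=
  MVField (msmooth_mvect (vfield_smooth b)).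

Lemma ext_apply_smooth t b i : smooth (fun p => (t p *m b p) i 0).
Proof.
apply: smooth_mulmx => [|j l]; first exact: extfield_smooth.
by rewrite ord1; apply: vfield_smooth.
Qed.

Definition ext_apply t b : vfield U := VField (ext_apply_smooth t b).

Definition ext_extended t X : mvfield U :=
  MVField (msmooth_extended (extfield_smooth t) (mvfield_smooth X)).

Definition nonsingular t : Prop := forall p, t p \in unitmx.

Lemma ext_star_smooth t : nonsingular t ->
  forall i j, smooth (fun p => (invmx (t p))^T i j).
Proof.
move=> tu i j; apply: (@smooth_ext _ _ _ _ _ _ (fun p => invmx (t p) j i)).
  by move=> p; rewrite mxE.
by apply: smooth_invmx => // i' j'; apply: extfield_smooth.
Qed.

Definition ext_star t (tu : nonsingular t) : extfield U :=
  ExtField (ext_star_smooth tu).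

Definition metric_field k : Prop :=
  forall p, (k p)^T = k p /\ \det (k p) != 0.

Definition orthogonal_metric_field eta : Prop :=
  metric_field eta /\ forall p, (eta p)^T = invmx (eta p).

Record gauge_metric_field g eta h : Prop := GaugeMetricField {
  gauge_nonsingular : nonsingular h;
  gauge_orthogonal : orthogonal_metric_field eta;
  gauge_signature : forall p, same_signature (eta p) (g p);
  gauge_eq : forall p, g p = (h p)^T *m eta p *m h p }.

(* The derivative of X along a, coordinatewise in the fixed basis. *)
Definition dirder a X (p : U) : mvec R n :=
  [ffun S => \sum_i a p i 0 * partial i (fun q => X q S) p].

(* The families (a, X) |-> (D+_a X, D-_a X). *)
Definition operator_pair : Type :=
  ((vfield U -> mvfield U -> mvfield U) *
   (vfield U -> mvfield U -> mvfield U))%type.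

Implicit Type D : operator_pair.

Definition dcdo_of (gamma : connection U) D : Prop :=
  forall a X p,
    D.1 a X p = dirder a X p + generalized_of (gamma p (a p)) (X p) /\
    D.2 a X p = dirder a X p - madjoint (generalized_of (gamma p (a p))) (X p).

Definition is_dcdo_pair D : Prop := exists gamma, dcdo_of gamma D.

(* D-_a (k b) - k (D+_a b): the covariant derivative of a vector field is a
   vector field, to which k is applied through its grade 1 coordinates. *)
Definition ext_covderiv D k a b (p : U) : mvec R n :=
  D.2 a (mvect_field (ext_apply k b)) p
  - mvect (k p *m vpart (D.1 a (mvect_field b) p)).

Definition compatible k D : Prop := forall a b p, ext_covderiv D k a b p = 0.

Definition gauge_related h (hu : nonsingular h) D D' : Prop :=
  forall a X,
    ext_extended h (D.1 a X) = D'.1 a (ext_extended h X) /\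
    ext_extended (ext_star hu) (D.2 a X)
      = D'.2 a (ext_extended (ext_star hu) X).

End Operators.

(* The definitions above do give the exterior algebra with its operations. *)
Section ExteriorAlgebraFacts.
Local Close Scope classical_set_scope.
Local Open Scope set_scope.
Local Open Scope ring_scope.
Context {R : realType} {n : nat}.
Implicit Types (v w : vec R n) (X Y Z : mvec R n) (S T A B C : {set 'I_n}).

Lemma inversionsE S T :
  inversions S T = (\sum_(i in S) \sum_(j in T) (j < i)%N)%N.
Proof.
rewrite /inversions -sum1_card pair_big_dep /= big_mkcond [RHS]big_mkcond /=.
apply: eq_bigr => -[i j] _ /=; rewrite inE /=.
by case: (i \in S); case: (j \in T); case: (j < i)%N.
Qed.

Lemma disjointsU A B C :
  [disjoint A :|: B & C] = [disjoint A & C] && [disjoint B & C].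
Proof. by rewrite -disjointU; apply: eq_disjoint => i; rewrite !inE. Qed.

Lemma sum_setU (B C : {set 'I_n}) (F : 'I_n -> nat) : [disjoint B & C] ->
  (\sum_(i in B :|: C) F i = \sum_(i in B) F i + \sum_(i in C) F i)%N.
Proof.
move=> d; rewrite -bigU //=; apply: eq_bigl => i.
by rewrite !inE.
Qed.

Lemma inversionsUl A B C : [disjoint A & B] ->
  inversions (A :|: B) C = (inversions A C + inversions B C)%N.
Proof. by move=> dAB; rewrite !inversionsE sum_setU. Qed.

Lemma inversionsUr A B C : [disjoint B & C] ->
  inversions A (B :|: C) = (inversions A B + inversions A C)%N.
Proof.
move=> dBC; rewrite !inversionsE -big_split /=.
by apply: eq_bigr => i _; rewrite sum_setU.
Qed.

Lemma wedgeDl X Y Z : wedge (X + Y) Z = wedge X Z + wedge Y Z.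
Proof.
apply/ffunP => S; rewrite !ffunE -big_split /=; apply: eq_bigr => A _.
by rewrite ffunE mulrDl mulrDr.
Qed.

Lemma wedgeDr X Y Z : wedge X (Y + Z) = wedge X Y + wedge X Z.
Proof.
apply/ffunP => S; rewrite !ffunE -big_split /=; apply: eq_bigr => A _.
by rewrite ffunE !mulrDr.
Qed.

Lemma wedgeZl (c : R) X Y : wedge (c *: X) Y = c *: wedge X Y.
Proof.
apply/ffunP => S; rewrite !ffunE scaler_sumr; apply: eq_bigr => A _.
by rewrite ffunE /= -[c *: X A]/(c * X A) -[c *: _]/(c * _) -mulrA mulrCA.
Qed.

Lemma wedgeZr (c : R) X Y : wedge X (c *: Y) = c *: wedge X Y.
Proof.
apply/ffunP => S; rewrite !ffunE scaler_sumr; apply: eq_bigr => A _.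
rewrite ffunE /= -[c *: Y _]/(c * Y _) -[c *: _]/(c * _).
by rewrite [RHS]mulrCA [c * (_ * _)]mulrCA.
Qed.

Lemma wedge0l X : wedge 0 X = 0.
Proof. by have := wedgeZl 0 X X; rewrite !scale0r. Qed.

Lemma wedge0r X : wedge X 0 = 0.
Proof. by have := wedgeZr 0 X X; rewrite !scale0r. Qed.

Lemma wedge_suml (I : Type) (r : seq I) (P : pred I) F Y :
  wedge (\sum_(i <- r | P i) F i) Y = \sum_(i <- r | P i) wedge (F i) Y.
Proof. by apply: (big_morph (wedge^~ Y)) => [? ?|]; [exact: wedgeDl|exact: wedge0l]. Qed.

Lemma wedge_sumr (I : Type) (r : seq I) (P : pred I) F X :
  wedge X (\sum_(i <- r | P i) F i) = \sum_(i <- r | P i) wedge X (F i).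
Proof. by apply: (big_morph (wedge X)) => [? ?|]; [exact: wedgeDr|exact: wedge0r]. Qed.

Lemma mvec_blades X : X = \sum_S X S *: blade S.
Proof.
apply/ffunP => T; rewrite sum_ffunE (bigD1 T) //= big1 ?addr0; last first.
  by move=> S ST; rewrite !ffunE eq_sym (negPf ST) [LHS]mulr0.
by rewrite !ffunE eqxx [RHS]mulr1.
Qed.

Lemma wedge_blade A B : wedge (blade A) (blade B) =
  if [disjoint A & B] then (-1) ^+ inversions A B *: blade (A :|: B)
  else 0 :> mvec R n.
Proof.
apply/ffunP => S; rewrite ffunE.
have [AS|nAS] := boolP (A \subset S); last first.
  rewrite big1 => [|T TS].
    case: ifP; rewrite ?ffunE // => _.
    case: eqP => [SE|_]; last by rewrite [RHS]mulr0.
    by rewrite SE finset.subsetUl in nAS.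
  rewrite !ffunE; case: eqP => [TA|]; last by rewrite mul0r mulr0.
  by rewrite TA (negPf nAS) in TS.
rewrite (bigD1 A) //= big1 ?addr0; last first.
  by move=> T /andP[_ TA]; rewrite !ffunE (negPf TA) mul0r mulr0.
rewrite !ffunE eqxx mul1r.
case: (altP (S :\: A =P B)) => [<-|SB].
  have dj : [disjoint A & S :\: A].
    by apply/pred0P => x; rewrite /= !inE; case: (x \in A).
  by rewrite dj ffunE finset.setDE finset.setUIr finset.setUCr finset.setIT (finset.setUidPr AS) ffunE eqxx.
rewrite mulr0; case: ifP => dj; rewrite ffunE // ffunE.
case: eqP => [SE|_]; last by rewrite [RHS]mulr0.
case/eqP: SB; rewrite SE finset.setDUl finset.setDv finset.set0U.
by apply/finset.setDidPl; rewrite disjoint_sym.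
Qed.

Lemma bladesA A B C : wedge (blade A) (wedge (blade B) (blade C)) =
  wedge (wedge (blade A) (blade B)) (blade C) :> mvec R n.
Proof.
rewrite !wedge_blade.
have [dBC|nBC] := boolP [disjoint B & C]; last first.
  rewrite wedge0r; case: ifP => _; last by rewrite wedge0l.
  by rewrite wedgeZl wedge_blade disjointsU (negPf nBC) andbF scaler0.
rewrite wedgeZr wedge_blade.
have [dAB|nAB] := boolP [disjoint A & B]; last first.
  by rewrite wedge0l disjoint_sym disjointsU disjoint_sym (negPf nAB) /= scaler0.
rewrite wedgeZl wedge_blade disjointsU dBC andbT.
rewrite [in LHS]disjoint_sym disjointsU ![[disjoint _ & A]]disjoint_sym dAB /=.
case: ifP => dAC; last by rewrite !scaler0.
rewrite !scalerA -!exprD inversionsUl // inversionsUr // finset.setUA.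
by congr (_ ^+ _ *: _); rewrite addnCA [in RHS]addnC -!addnA [in RHS]addnCA addnC -!addnA.
Qed.

Lemma wedgeA X Y Z : wedge X (wedge Y Z) = wedge (wedge X Y) Z.
Proof.
have L1 A B (T : mvec R n) : wedge (blade A) (wedge (blade B) T) =
    wedge (wedge (blade A) (blade B)) T :> mvec R n.
  rewrite (mvec_blades T) !wedge_sumr; apply: eq_bigr => C _.
  by rewrite !wedgeZr bladesA.
have L2 A (T V : mvec R n) : wedge (blade A) (wedge T V) = wedge (wedge (blade A) T) V.
  rewrite (mvec_blades T) wedge_suml !wedge_sumr wedge_suml.
  by apply: eq_bigr => B _; rewrite wedgeZl !wedgeZr wedgeZl L1.
rewrite (mvec_blades X) !wedge_suml.
by apply: eq_bigr => A _; rewrite !wedgeZl L2.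
Qed.

Lemma inversions0l A : inversions finset.set0 A = 0%N.
Proof. by rewrite inversionsE big1 // => i; rewrite inE. Qed.

Lemma wedge1l (c : R) X : wedge (mscal c) X = c *: X.
Proof.
rewrite wedgeZl; congr (_ *: _).
rewrite [in RHS](mvec_blades X) {1}(mvec_blades X) wedge_sumr.
apply: eq_bigr => A _; rewrite wedgeZr wedge_blade inversions0l.
by rewrite -setI_eq0 finset.set0I eqxx finset.set0U scale1r.
Qed.

Lemma mvect_bvec i : mvect (bvec i) = blade [set i] :> mvec R n.
Proof.
rewrite /mvect (bigD1 i) //= big1 ?addr0 ?mxE ?eqxx ?scale1r // => j ji.
by rewrite mxE (negPf ji) scale0r.
Qed.

Lemma inversions1l i S : inversions [set i] S = (\sum_(j in S) (j < i)%N)%N.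
Proof. by rewrite inversionsE big_set1. Qed.

Lemma wedge_bvec_anti i j :
  wedge (blade [set i]) (blade [set j]) =
  - wedge (blade [set j]) (blade [set i]) :> mvec R n.
Proof.
rewrite !wedge_blade !finset.disjoints1 !inE eq_sym.
case: eqP => [_|/eqP ij]; first by rewrite oppr0.
rewrite finset.setUC !inversions1l !big_set1 -scaleNr; congr (_ *: _).
by have := ij; rewrite -val_eqE /=; case: ltngtP; rewrite ?opprK.
Qed.

Lemma wedge_mvectC v w : wedge (mvect v) (mvect w) = - wedge (mvect w) (mvect v).
Proof.
rewrite /mvect !wedge_suml -sumrN.
under eq_bigr do rewrite wedge_sumr.
rewrite exchange_big /=; apply: eq_bigr => i _; rewrite wedge_sumr -sumrN.
apply: eq_bigr => j _; rewrite !wedgeZl !wedgeZr wedge_bvec_anti !scalerN.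
by rewrite !scalerA mulrC.
Qed.

Lemma wedge_mvect_mvect v : wedge (mvect v) (mvect v) = 0.
Proof.
apply/ffunP => S; have /ffunP/(_ S) := wedge_mvectC v v.
rewrite [in X in _ = X -> _]ffunE => /eqP; rewrite -subr_eq0 opprK -mulr2n.
by rewrite mulrn_eq0 /= [RHS]ffunE => /eqP.
Qed.

Lemma lcontrDr v X Y : lcontr v (X + Y) = lcontr v X + lcontr v Y.
Proof.
apply/ffunP => S; rewrite !ffunE -big_split /=; apply: eq_bigr => i _.
by rewrite ffunE !mulrDr.
Qed.

Lemma lcontrZr v c X : lcontr v (c *: X) = c *: lcontr v X.
Proof.
apply/ffunP => S; rewrite !ffunE scaler_sumr; apply: eq_bigr => i _.
rewrite ffunE /= -[c *: X _]/(c * X _) -[c *: _]/(c * _).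
by rewrite [RHS]mulrCA [c * (_ * _)]mulrCA.
Qed.

Lemma lcontr0r v : lcontr v 0 = 0.
Proof. by have := lcontrZr v 0 0; rewrite !scale0r. Qed.

Lemma lcontr_sumr v (I : Type) (r : seq I) (P : pred I) F :
  lcontr v (\sum_(i <- r | P i) F i) = \sum_(i <- r | P i) lcontr v (F i).
Proof. by apply: (big_morph (lcontr v)) => [? ?|]; [exact: lcontrDr|exact: lcontr0r]. Qed.

Lemma lcontr_bvecs v X : lcontr v X = \sum_i v i 0 *: lcontr (bvec i) X.
Proof.
apply/ffunP => S; rewrite sum_ffunE ffunE [RHS](bigID (fun i => i \in S)) /=.
rewrite [X in _ = X + _]big1 ?add0r => [|i iS].
  apply: eq_bigr => i iS; rewrite !ffunE (bigD1 i) //= big1 ?addr0.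
    by rewrite mxE !eqxx mul1r -[RHS]/(_ * _) mulrCA.
  by move=> j /andP[_ ji]; rewrite mxE (negPf ji) mul0r mulr0.
rewrite !ffunE big1 ?scaler0 // => j jS; rewrite mxE.
by case: eqP => [ji|_]; rewrite ?mul0r ?mulr0 //; move: jS; rewrite ji iS.
Qed.

Lemma lcontr_blade i S : lcontr (bvec i) (blade S) =
  (if i \in S then (-1) ^+ inversions [set i] S *: blade (S :\ i) else 0) :> mvec R n.
Proof.
apply/ffunP => T; rewrite ffunE.
have [iT|iT] := boolP (i \in T).
  rewrite big1 => [|j jT].
    case: ifP => iS; rewrite !ffunE //; case: eqP => [TE|_]; last by rewrite [RHS]mulr0.
    by move: iT; rewrite TE !inE eqxx.
  rewrite mxE; case: eqP => [ji|_]; rewrite ?mul0r ?mulr0 //.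
  by move: jT; rewrite ji iT.
rewrite (bigD1 i) //= big1 ?addr0; last first.
  by move=> j /andP[_ ji]; rewrite mxE (negPf ji) mul0r mulr0.
rewrite !mxE !eqxx mul1r !ffunE.
case: (altP (i |: T =P S)) => [<-|iTS].
  rewrite finset.setU11 !ffunE finset.setU1K // eqxx; congr (_ ^+ _ * _).
  by rewrite !inversions1l big_setU1 //= ltnn.
rewrite mulr0; case: ifP => iS; rewrite !ffunE //.
case: eqP => [TE|_]; last by rewrite [RHS]mulr0.
by case/eqP: iTS; rewrite TE finset.setD1K.
Qed.

Lemma lcontr_bvec_wedge i j X :
  lcontr (bvec i) (wedge (mvect (bvec j)) X) =
  (i == j)%:R *: X - wedge (mvect (bvec j)) (lcontr (bvec i) X).
Proof.
rewrite mvect_bvec (mvec_blades X) !wedge_sumr !lcontr_sumr wedge_sumr.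
rewrite scaler_sumr -sumrB; apply: eq_bigr => S _.
rewrite wedgeZr !lcontrZr wedgeZr scalerA mulrC -scalerA -scalerBr.
congr (_ *: _); rewrite lcontr_blade wedge_blade finset.disjoints1.
have [<-|ij] := eqVneq i j.
  have [iS|iS] := boolP (i \in S) => /=; rewrite scale1r.
    rewrite lcontr0r wedgeZr wedge_blade finset.disjoints1 !inE eqxx /=.
    rewrite finset.setD1K // scalerA -exprD !inversions1l (big_setD1 i) //= ltnn add0n.
    by rewrite addnn -signr_odd odd_double scale1r subrr.
  rewrite wedge0r subr0 lcontrZr lcontr_blade finset.setU11 finset.setU1K //.
  rewrite scalerA -exprD !inversions1l big_setU1 //= ltnn add0n.
  by rewrite addnn -signr_odd odd_double scale1r.
rewrite scale0r sub0r.
have [jS|jS] := boolP (j \in S) => /=.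
  rewrite lcontr0r; case: ifP => iS; last by rewrite wedge0r oppr0.
  by rewrite wedgeZr wedge_blade finset.disjoints1 !inE eq_sym ij jS scaler0 oppr0.
rewrite lcontrZr lcontr_blade !inE (negPf ij) /=.
case: ifP => iS; last by rewrite scaler0 wedge0r oppr0.
rewrite wedgeZr wedge_blade finset.disjoints1 !inE (negPf jS) andbF /=.
rewrite !scalerA -!exprD -scaleNr.
have -> : (j |: S) :\ i = j |: (S :\ i).
  apply/finset.setP => k; rewrite !inE.
  by case: (eqVneq k i) => // ->; rewrite (negPf ij).
congr (_ *: _); rewrite !inversions1l big_setU1 //=.
rewrite (big_setD1 i iS (F := fun k : 'I_n => nat_of_bool (k < j)%N)) /=.
have := ij; rewrite -val_eqE /=.
set a := (\sum_(_ in _) _)%N; set b := (\sum_(_ in _) _)%N.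
rewrite -signr_odd -[in RHS]signr_odd /= !oddD; case: ltngtP => //= _ _;
  by case: (odd a); case: (odd b); rewrite /= ?expr0 ?expr1 ?opprK.
Qed.

Lemma dotE v w : (v^T *m w) 0 0 = \sum_i v i 0 * w i 0.
Proof. by rewrite mxE; apply: eq_bigr => i _; rewrite mxE. Qed.

Lemma mvect_sum v : mvect v = \sum_i v i 0 *: mvect (bvec i).
Proof. by apply: eq_bigr => i _; rewrite mvect_bvec. Qed.

Lemma lcontr_wedge v w X :
  lcontr v (wedge (mvect w) X) =
  (v^T *m w) 0 0 *: X - wedge (mvect w) (lcontr v X).
Proof.
rewrite (lcontr_bvecs v) (lcontr_bvecs v X) wedge_sumr dotE scaler_suml -sumrB.
apply: eq_bigr => i _; rewrite wedgeZr -scalerA -scalerBr; congr (_ *: _).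
rewrite mvect_sum !wedge_suml lcontr_sumr.
under eq_bigr do rewrite wedgeZl lcontrZr lcontr_bvec_wedge scalerBr.
rewrite sumrB; congr (_ - _); last by apply: eq_bigr => j _; rewrite wedgeZl.
rewrite (bigD1 i) //= big1 ?addr0 ?eqxx ?scale1r // => j ji.
by rewrite eq_sym (negPf ji) scale0r scaler0.
Qed.

Lemma lcontr_mscal v c : lcontr v (mscal c) = 0.
Proof.
rewrite lcontrZr lcontr_bvecs big1 ?scaler0 // => i _.
by rewrite lcontr_blade inE scaler0.
Qed.

Lemma mdotC X Y : mdot X Y = mdot Y X.
Proof. by apply: eq_bigr => S _; rewrite mulrC. Qed.

Lemma mdotDl X Y Z : mdot (X + Y) Z = mdot X Z + mdot Y Z.
Proof. by rewrite -big_split; apply: eq_bigr => S _; rewrite ffunE mulrDl. Qed.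

Lemma mdotZl c X Y : mdot (c *: X) Y = c * mdot X Y.
Proof. by rewrite mulr_sumr; apply: eq_bigr => S _; rewrite ffunE -mulrA. Qed.

Lemma mdot0l X : mdot 0 X = 0.
Proof. by rewrite /mdot big1 // => S _; rewrite ffunE mul0r. Qed.

Lemma mdot_suml (I : Type) (r : seq I) (P : pred I) F Y :
  mdot (\sum_(i <- r | P i) F i) Y = \sum_(i <- r | P i) mdot (F i) Y.
Proof. by apply: (big_morph (mdot^~ Y)) => [? ?|]; [exact: mdotDl|exact: mdot0l]. Qed.

Lemma mdotDr X Y Z : mdot X (Y + Z) = mdot X Y + mdot X Z.
Proof. by rewrite mdotC mdotDl !(mdotC _ X). Qed.

Lemma mdotZr c X Y : mdot X (c *: Y) = c * mdot X Y.
Proof. by rewrite mdotC mdotZl mdotC. Qed.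

Lemma mdot_sumr (I : Type) (r : seq I) (P : pred I) F X :
  mdot X (\sum_(i <- r | P i) F i) = \sum_(i <- r | P i) mdot X (F i).
Proof. by rewrite mdotC mdot_suml; apply: eq_bigr => i _; rewrite mdotC. Qed.

Lemma mdot0r X : mdot X 0 = 0.
Proof. by rewrite mdotC mdot0l. Qed.

Lemma mdot_blade X S : mdot X (blade S) = X S.
Proof.
rewrite /mdot (bigD1 S) //= big1 ?addr0 ?ffunE ?eqxx ?mulr1 // => T TS.
by rewrite ffunE (negPf TS) mulr0.
Qed.

Lemma madjointP (F : {linear mvec R n -> mvec R n}) X Y :
  mdot (F X) Y = mdot X (madjoint F Y).
Proof.
rewrite {1}(mvec_blades X) linear_sum mdot_suml; apply: eq_bigr => S _.
by rewrite linearZ mdotZl ffunE.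
Qed.

Lemma mdot_wedge v X Y : mdot (wedge (mvect v) X) Y = mdot X (lcontr v Y).
Proof.
rewrite mvect_sum wedge_suml mdot_suml lcontr_bvecs mdot_sumr.
apply: eq_bigr => i _; rewrite wedgeZl mdotZl mdotZr; congr (_ * _).
rewrite mvect_bvec (mvec_blades X) wedge_sumr !mdot_suml; apply: eq_bigr => A _.
rewrite wedgeZr !mdotZl; congr (_ * _).
rewrite (mvec_blades Y) lcontr_sumr !mdot_sumr; apply: eq_bigr => B _.
rewrite lcontrZr !mdotZr; congr (_ * _).
rewrite mdot_blade wedge_blade finset.disjoints1 lcontr_blade mdotC.
have [iA|iA] := boolP (i \in A) => /=.
  rewrite ffunE; case: ifP => iB; last by rewrite mdot0l.
  rewrite mdotZl mdot_blade ffunE; case: eqP => [AE|_]; last by rewrite mulr0.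
  by move: iA; rewrite AE !inE eqxx.
rewrite !ffunE; case: (altP (B =P i |: A)) => [->|BA].
  rewrite finset.setU11 finset.setU1K // mdotZl mdot_blade ffunE eqxx.
  by rewrite !inversions1l big_setU1 //= ltnn.
rewrite [LHS]mulr0; case: ifP => iB; last by rewrite mdot0l.
rewrite mdotZl mdot_blade ffunE; case: eqP => [AE|_]; last by rewrite mulr0.
by case/eqP: BA; rewrite AE finset.setD1K.
Qed.

Definition wedgef k (f : 'I_k -> vec R n) : mvec R n :=
  wedges [seq f i | i <- enum 'I_k].

Lemma wedgefS k (f : 'I_k.+1 -> vec R n) :
  wedgef f = wedge (mvect (f ord0)) (wedgef (f \o lift ord0)).
Proof. by rewrite /wedgef enum_ordSl /= -map_comp. Qed.

Lemma lcontr_wedgef k v (g : 'I_k.+1 -> vec R n) :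
  lcontr v (wedgef g) =
  \sum_(j < k.+1) ((-1) ^+ j * (v^T *m g j) 0 0) *: wedgef (g \o lift j).
Proof.
elim: k g => [|k IH] g.
  rewrite wedgefS lcontr_wedge big_ord1 expr0 mul1r.
  have e (f : 'I_0 -> vec R n) : wedgef f = mscal 1.
    by rewrite /wedgef (size0nil (_ : size (enum 'I_0) = 0%N)) ?size_enum_ord.
  by rewrite !e lcontr_mscal wedge0r subr0.
rewrite wedgefS lcontr_wedge IH [RHS]big_ord_recl expr0 mul1r; congr (_ + _).
rewrite wedge_sumr -sumrN; apply: eq_bigr => j _.
rewrite [in RHS]wedgefS wedgeZr -scaleNr /= -mulNr exprS mulN1r.
congr (_ *: wedge (mvect (g _)) (wedges _)); first exact: val_inj.
by apply: eq_map => i /=; congr g; apply: val_inj; rewrite /= !bumpS.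
Qed.

Lemma mdot_wedgef k (f g : 'I_k -> vec R n) :
  mdot (wedgef f) (wedgef g) = \det (\matrix_(i, j) ((f i)^T *m g j) 0 0).
Proof.
elim: k f g => [|k IH] f g.
  rewrite det_mx00 /wedgef (size0nil (_ : size (enum 'I_0) = 0%N)) ?size_enum_ord //=.
  by rewrite mdotZl mdotZr mdot_blade ffunE eqxx !mulr1.
rewrite wedgefS mdot_wedge lcontr_wedgef mdot_sumr (expand_det_row _ ord0).
apply: eq_bigr => j _; rewrite mdotZr IH [X in _ = X * _]mxE /cofactor add0n [RHS]mulrCA mulrA.
by congr (_ * \det _); apply/matrixP => a b; rewrite !mxE.
Qed.

Lemma wedges_grade (vs : seq (vec R n)) S : #|S| != size vs -> wedges vs S = 0.
Proof.
elim: vs S => [|v vs IH] S /=.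
  have [->|S0 _] := eqVneq S finset.set0; first by rewrite cards0.
  by rewrite !ffunE (negPf S0); exact: mulr0.
move=> Sv; rewrite mvect_sum wedge_suml sum_ffunE big1 // => i _.
rewrite wedgeZl mvect_bvec !ffunE big1 => [|A AS]; first exact: mulr0.
rewrite ffunE; case: eqP => [AE|_]; last by rewrite mul0r mulr0.
rewrite IH ?mulr0 //; apply: contra Sv => /eqP Sv.
move: AS; rewrite AE finset.sub1set => iS.
by rewrite AE in Sv; rewrite (cardsD1 i) iS Sv.
Qed.

Lemma mdot_wedges_grade (vs ws : seq (vec R n)) :
  size vs != size ws -> mdot (wedges vs) (wedges ws) = 0.
Proof.
move=> vw; rewrite /mdot big1 // => S _.
have [Sv|Sv] := eqVneq #|S| (size vs); last by rewrite wedges_grade // mul0r.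
by rewrite [X in _ * X]wedges_grade ?mulr0 // Sv.
Qed.

Lemma wedges_cat (vs ws : seq (vec R n)) :
  wedges (vs ++ ws) = wedge (wedges vs) (wedges ws).
Proof. by elim: vs => [|v vs IH] /=; rewrite ?wedge1l ?scale1r // IH wedgeA. Qed.

Lemma wedge_mvect_self v X : wedge (mvect v) (wedge (mvect v) X) = 0.
Proof. by rewrite wedgeA wedge_mvect_mvect wedge0l. Qed.

Lemma wedge_wedges v (vs ws : seq (vec R n)) :
  wedge (mvect v) (wedges (vs ++ ws)) =
  (-1) ^+ size vs *: wedges (vs ++ v :: ws).
Proof.
elim: vs => [|w vs IH] /=; first by rewrite expr0 scale1r.
rewrite wedgeA wedge_mvectC -scaleN1r wedgeZl -wedgeA IH wedgeZr scalerA.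
by rewrite exprS.
Qed.

Lemma wedges_eq0 v (vs ws : seq (vec R n)) :
  wedge (mvect v) (wedges (vs ++ v :: ws)) = 0.
Proof.
rewrite wedge_wedges wedges_cat /= wedge_mvect_self wedge0r.
exact: scaler0.
Qed.

Local Notation below i S := [seq j : 'I_n <- enum S | (j < i)%N].
Local Notation above i S := [seq j : 'I_n <- enum S | (i < j)%N].

Lemma enum_ltn_sorted S : sorted (fun a b : 'I_n => (a < b)%N) (enum S).
Proof.
rewrite /enum_mem -enumT sorted_filter //; first by move=> a b c; apply: ltn_trans.
by have := iota_ltn_sorted 0 n; rewrite -val_enum_ord sorted_map.
Qed.

Lemma mem_filter_enum S (P : pred 'I_n) a :
  (a \in [seq j <- enum S | P j]) = P a && (a \in S).
Proof. by rewrite mem_filter mem_enum. Qed.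

Lemma enum_split i S (m : seq 'I_n) : sorted (fun a b : 'I_n => (a < b)%N) m ->
  {subset m <= pred1 i} ->
  enum [set k | (k \in below i S ++ m ++ above i S)] = below i S ++ m ++ above i S.
Proof.
move=> ms mi.
apply: (@irr_sorted_eq _ (fun a b : 'I_n => (a < b)%N)).
- by move=> a b c; apply: ltn_trans.
- by move=> a; rewrite /= ltnn.
- exact: enum_ltn_sorted.
- have tr : transitive (fun a b : 'I_n => (a < b)%N).
    by move=> a b c; apply: ltn_trans.
  rewrite (sorted_pairwise tr) !pairwise_cat -!(sorted_pairwise tr) ms.
  have es := enum_ltn_sorted S.
  rewrite (sorted_filter tr _ es) (sorted_filter tr _ es) !andbT.
  rewrite allrel_catr -andbA; apply/and3P; split;
    apply/allrelP => a b; rewrite ?mem_filter.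
  - by move=> /andP[ai _] /mi /eqP ->.
  - by move=> /andP[ai _] /andP[ib _]; apply: ltn_trans ib.
  - by move=> /mi /eqP -> /andP[].
by move=> a; rewrite mem_enum inE.
Qed.

Lemma enum_setU1 i S : enum (i |: S) = below i S ++ i :: above i S.
Proof.
rewrite -[i :: _]/([:: i] ++ _) -enum_split //; last by move=> j; rewrite inE.
apply: eq_enum => a; rewrite !inE !mem_cat !mem_filter_enum inE -val_eqE.
by case: ltngtP; rewrite /= ?orbF ?orbT.
Qed.

Lemma enum_setN i S : i \notin S -> enum S = below i S ++ above i S.
Proof.
move=> iS; rewrite -[above i S]/([::] ++ _) -enum_split //.
apply: eq_enum => a; rewrite !inE !mem_cat !mem_filter_enum.
case: ltngtP => //= [|/val_inj ->]; rewrite ?orbF //.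
exact: negPf.
Qed.

Lemma extended_blade (t : vec R n -> vec R n) S :
  extended_of t (blade S) = wedges [seq t (bvec i) | i <- enum S].
Proof.
rewrite /extended_of (bigD1 S) //= big1 ?addr0 => [|T TS].
  by rewrite ffunE eqxx scale1r.
by rewrite ffunE (negPf TS) scale0r.
Qed.

Lemma extended_linear (t : vec R n -> vec R n) : linear (extended_of t).
Proof.
move=> c X Y; rewrite scaler_sumr -big_split /=; apply: eq_bigr => S _.
by rewrite !ffunE scalerDl scalerA.
Qed.

Lemma extendedZ (t : vec R n -> vec R n) c X :
  extended_of t (c *: X) = c *: extended_of t X.
Proof.
rewrite scaler_sumr; apply: eq_bigr => S _.
by rewrite !ffunE scalerA.
Qed.

Lemma extended_sum (t : vec R n -> vec R n) (I : Type) (r : seq I) (P : pred I) F :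
  extended_of t (\sum_(i <- r | P i) F i) = \sum_(i <- r | P i) extended_of t (F i).
Proof.
apply: (big_morph (extended_of t)) => [X Y|].
  by have := extended_linear t 1 X Y; rewrite !scale1r.
by have := extendedZ t 0 0; rewrite !scale0r.
Qed.

Lemma mvectZ c v : mvect (c *: v) = c *: mvect v.
Proof.
by rewrite scaler_sumr; apply: eq_bigr => i _; rewrite mxE scalerA.
Qed.

Lemma mvectD v w : mvect (v + w) = mvect v + mvect w.
Proof.
by rewrite -big_split; apply: eq_bigr => i _; rewrite mxE scalerDl.
Qed.

Lemma vec_sum v : v = \sum_i v i 0 *: bvec i.
Proof.
apply/colP => k; rewrite summxE (bigD1 k) //= big1 ?addr0.
  by rewrite !mxE !eqxx mulr1.
by move=> j jk; rewrite !mxE eq_sym (negPf jk) mulr0.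
Qed.

Lemma mvect_lin (t : {linear vec R n -> vec R n}) v :
  mvect (t v) = \sum_i v i 0 *: mvect (t (bvec i)).
Proof.
rewrite {1}(vec_sum v) linear_sum /=.
rewrite (big_morph mvect mvectD (_ : mvect 0 = 0)).
  by apply: eq_bigr => i _; rewrite linearZ mvectZ.
by have := mvectZ 0 0; rewrite !scale0r.
Qed.

Lemma extended_wedge (t : {linear vec R n -> vec R n}) v X :
  extended_of t (wedge (mvect v) X) = wedge (mvect (t v)) (extended_of t X).
Proof.
rewrite mvect_lin (mvect_sum v) !wedge_suml extended_sum; apply: eq_bigr => i _.
rewrite !wedgeZl extendedZ; congr (_ *: _).
rewrite (mvec_blades X) wedge_sumr !extended_sum wedge_sumr; apply: eq_bigr => S _.
rewrite wedgeZr !extendedZ wedgeZr; congr (_ *: _).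
rewrite mvect_bvec wedge_blade finset.disjoints1 extended_blade.
have [iS|iS] := boolP (i \in S) => /=.
  have := enum_setU1 i S; rewrite (_ : i |: S = S); last first.
    by apply/finset.setUidPr; rewrite finset.sub1set.
  move=> ->; rewrite map_cat /= wedges_eq0.
  by have := extendedZ t 0 0; rewrite !scale0r.
rewrite extendedZ extended_blade enum_setU1 [in RHS](enum_setN iS) !map_cat /=.
rewrite wedge_wedges size_map; congr (_ ^+ _ *: _).
by rewrite inversions1l size_filter -big_enum /= -sum1_count [RHS]big_mkcond.
Qed.

Lemma generalized_wedge (t : {linear vec R n -> vec R n}) v X :
  generalized_of t (wedge (mvect v) X) =
  wedge (mvect (t v)) X + wedge (mvect v) (generalized_of t X).
Proof.
have -> : wedge (mvect (t v)) X = \sum_i v i 0 *: wedge (mvect (t (bvec i))) X.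
  rewrite mvect_lin wedge_suml.
  by apply: eq_bigr => i _; rewrite wedgeZl.
rewrite wedge_sumr -big_split; apply: eq_bigr => i _ /=.
have -> : lcontr (bvec i) (wedge (mvect v) X) =
    v i 0 *: X - wedge (mvect v) (lcontr (bvec i) X).
  rewrite lcontr_wedge dotE (bigD1 i) //= big1 ?addr0; last first.
    by move=> j ji; rewrite mxE (negPf ji) mul0r.
  by rewrite mxE !eqxx mul1r.
rewrite wedgeDr wedgeZr; congr (_ + _).
rewrite -(scaleN1r (wedge (mvect v) _)) wedgeZr !wedgeA (wedge_mvectC v).
by rewrite -(scaleN1r (wedge (mvect (t _)) _)) wedgeZl.
Qed.

Lemma generalized_mscal (t : vec R n -> vec R n) c : generalized_of t (mscal c) = 0.
Proof.
by rewrite /generalized_of big1 // => i _; rewrite lcontr_mscal wedge0r.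
Qed.

Lemma bladeE S : blade S = wedges [seq bvec i | i <- enum S] :> mvec R n.
Proof.
have [k] := ubnP #|S|; elim: k S => // k IH S Sk.
have [->|[i iS]] := finset.set_0Vmem S.
  by rewrite enum_set0 /= [RHS]scale1r.
have SE := finset.setD1K iS.
have iS' : i \notin S :\ i by rewrite !inE eqxx.
rewrite -SE enum_setU1 map_cat /=.
have := wedge_wedges (bvec i) (map bvec (below i (S :\ i)))
  (map bvec (above i (S :\ i))).
rewrite -map_cat -enum_setN // -IH; last first.
  by move: Sk; rewrite (cardsD1 i) iS.
rewrite mvect_bvec wedge_blade finset.disjoints1 iS' size_map.
rewrite inversions1l -big_enum /= size_filter.
rewrite (_ : (\sum_(j <- _) _)%N = count (fun j : 'I_n => (j < i)%N) (enum (S :\ i))).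
  by move=> h; apply: (scalerI _ h); rewrite signr_eq0.
by rewrite -sum1_count [RHS]big_mkcond.
Qed.

End ExteriorAlgebraFacts.

(* Main.v *)
Require Import Defs.
From HB Require Import structures.
From mathcomp Require Import all_boot all_order all_algebra.
From mathcomp Require Import all_classical all_reals all_analysis.

(** Write h_ for the extended of h, and h* for the transpose of its inverse.
Since h_ is invertible, the two intertwining formulas leave no choice:

  D'+_a = h_ o D+_a o (h_)^-1   and   D'-_a = (h* )_ o D-_a o (h^T)_,

and the same formulas with h^-1 in place of h recover D from D'.  So both
halves of the theorem say that this transport of operator pairs preserves two
properties: being the pair of some connection field, and compatibility, with
the metric changed along k = h^T k' h.  The converse half is the transport by
h^-1, for which the metric changes back because eta = (h^-1)^T g h^-1.

Compatibility is a short computation: D-(k c) = k D+(c) with c = h^-1 b gives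
D'-(k' b) = h* D-(k c) = h* k D+(c) = k' h D+(c) = k' D'+(b).

That the transported pair comes from a connection rests on one identity
(conjugate_derivation).  For a smooth field of invertible matrices t, the
conjugate of d_a + Gen(A) by t_ is again a derivation of the same kind,

  t_ (d_a + Gen(A)) (t^-1)_ = d_a + Gen (t A t^-1 + t d_a(t^-1)),

where Gen is the generalized; it holds because Gen is the derivation of the
exterior algebra extending its argument and t_ is an algebra morphism.  With
t = h it yields the connection h gamma_a h^-1 + h d_a(h^-1) for D'+.  The
adjoint of Gen(A) is Gen(A^T) (madjoint_generalized), so D- has the same shape
with -gamma_a^T in place of gamma_a, and the identity with t = h* yields

  - h* gamma_a^T h^T + h* d_a(h^T),

which is minus the transpose of the former because d_a(h h^-1) = 0. *)

Set Implicit Arguments.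
Unset Strict Implicit.
Unset Printing Implicit Defensive.

Import Order.TTheory GRing.Theory Num.Theory.
Import numFieldNormedType.Exports.

Local Open Scope ring_scope.

(** * Extended and generalized of a matrix *)

Section Extended.
Context {R : realType} {n : nat}.
Implicit Types (A B : 'M[R]_n) (X Y : mvec R n) (v w : vec R n).

Notation ext A := (extended_of (mulmx A)).
Notation gen A := (generalized_of (mulmx A)).

Lemma generalized_linear (t : vec R n -> vec R n) : linear (generalized_of t).
Proof.
move=> c X Y; rewrite scaler_sumr -big_split; apply: eq_bigr => i _ /=.
by rewrite lcontrDr lcontrZr wedgeDr wedgeZr.
Qed.

HB.instance Definition _ (t : vec R n -> vec R n) :=
  GRing.isLinear.Build R (mvec R n) (mvec R n) _ (extended_of t)
    (extended_linear t).
HB.instance Definition _ (t : vec R n -> vec R n) :=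
  GRing.isLinear.Build R (mvec R n) (mvec R n) _ (generalized_of t)
    (generalized_linear t).

Lemma linear_mvec_blades (F : {linear mvec R n -> mvec R n}) X :
  F X = \sum_S X S *: F (blade S).
Proof.
by rewrite {1}(mvec_blades X) linear_sum; apply: eq_bigr => S _; rewrite linearZ.
Qed.

(** The lists r are not required to be increasing, so that an equality of two
linear maps can be proved by induction on r, one wedge factor at a time. *)
Lemma linear_mvec_ext (F G : {linear mvec R n -> mvec R n}) :
  (forall r : seq 'I_n, F (wedges [seq bvec i | i <- r])
    = G (wedges [seq bvec i | i <- r])) -> F =1 G.
Proof.
move=> FG X; rewrite !linear_mvec_blades; apply: eq_bigr => S _.
by rewrite bladeE FG.
Qed.

Lemma extended_mscal (t : vec R n -> vec R n) c :
  extended_of t (mscal c) = mscal c.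
Proof. by rewrite linearZ /= extended_blade enum_set0 /= /mscal scale1r. Qed.

Lemma extended_wedges A (vs : seq (vec R n)) :
  ext A (wedges vs) = wedges [seq A *m v | v <- vs].
Proof.
elim: vs => [|v vs IH] /=; first exact: extended_mscal.
by rewrite extended_wedge IH.
Qed.

Lemma extendedM A B X : ext A (ext B X) = ext (A *m B) X.
Proof.
move: X; apply: (@linear_mvec_ext (ext A \o ext B) (ext (A *m B))) => r /=.
rewrite !extended_wedges -!map_comp; congr wedges; apply: eq_map => i /=.
exact: mulmxA.
Qed.

Lemma extended1 X : ext 1%:M X = X.
Proof.
move: X; apply: (@linear_mvec_ext (ext 1%:M) idfun) => r /=.
rewrite extended_wedges -map_comp; congr wedges; apply: eq_map => i /=.
exact: mul1mx.
Qed.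

Lemma extendedK A B : B *m A = 1%:M -> cancel (ext A) (ext B).
Proof. by move=> BA X; rewrite extendedM BA extended1. Qed.

Lemma mvect_wedges v : mvect v = wedges [:: v].
Proof.
rewrite /= {1}mvect_sum mvect_sum wedge_suml; apply: eq_bigr => i _.
rewrite wedgeZl; congr (_ *: _).
rewrite mvect_bvec wedgeZr wedge_blade disjoint_sym.
by rewrite -finset.setI_eq0 finset.set0I eqxx finset.setU0 inversionsE
  exchange_big big_pred0 ?scale1r // => j; rewrite inE.
Qed.

Lemma extended_mvect A v : ext A (mvect v) = mvect (A *m v).
Proof. by rewrite !mvect_wedges extended_wedges. Qed.

Lemma generalized_mvect A v : gen A (mvect v) = mvect (A *m v).
Proof.
by rewrite !mvect_wedges /= generalized_wedge generalized_mscal wedge0r addr0.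
Qed.

Lemma vpart_mvect v : vpart (mvect v) = v.
Proof.
apply/colP => i; rewrite mxE sum_ffunE (bigD1 i) //= big1 => [|j ji].
  by rewrite addr0 !ffunE eqxx [LHS]mulr1.
rewrite !ffunE; case: eqP => [/finset.set1_inj ij|_]; last exact: mulr0.
by rewrite ij eqxx in ji.
Qed.

Lemma generalizedD A B X : gen (A + B) X = gen A X + gen B X.
Proof.
rewrite -big_split; apply: eq_bigr => i _ /=.
by rewrite mulmxDl mvectD wedgeDl.
Qed.

Lemma generalizedN A X : gen (- A) X = - gen A X.
Proof.
rewrite -sumrN; apply: eq_bigr => i _.
by rewrite mulNmx -scaleN1r mvectZ wedgeZl scaleN1r.
Qed.

Lemma eq_generalized (s t : vec R n -> vec R n) :
  (forall i, s (bvec i) = t (bvec i)) -> generalized_of s =1 generalized_of t.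
Proof. by move=> st X; apply: eq_bigr => i _; rewrite st. Qed.

(** Both sides are derivations along the algebra morphism extending A, and
they agree on vectors because A s = (A s B) A. *)
Lemma extended_generalized A B s X : B *m A = 1%:M ->
  ext A (gen s X) = gen (A *m s *m B) (ext A X).
Proof.
move=> BA; move: X.
apply: (@linear_mvec_ext (ext A \o gen s) (gen (A *m s *m B) \o ext A)).
elim=> [|i r /= IH] /=.
  by rewrite extended_mscal !generalized_mscal linear0.
rewrite generalized_wedge linearD /= !extended_wedge IH generalized_wedge /=.
by rewrite -!mulmxA (mulmxA B A) BA mul1mx.
Qed.

(** Contraction is adjoint to the exterior product, so the adjoint of
sum_i t(b_i) /\ (b_i _| X) is sum_i b_i /\ (t(b_i) _| X); expanding t(b_i) in
the basis turns it into the generalized of the transpose. *)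
Lemma madjoint_generalized A X : madjoint (gen A) X = gen A^T X.
Proof.
rewrite [RHS](_ : _ = \sum_i wedge (mvect (bvec i)) (lcontr (A *m bvec i) X)).
  apply/ffunP => S; rewrite ffunE mdot_suml -mdot_blade mdotC mdot_sumr.
  by apply: eq_bigr => i _; rewrite mdot_wedge [RHS]mdotC mdot_wedge mdotC.
have entry B i j : (B *m bvec j) i 0 = B i j.
  by rewrite -colE mxE.
transitivity (\sum_i \sum_j A i j *: wedge (mvect (bvec j)) (lcontr (bvec i) X)).
  apply: eq_bigr => i _; rewrite mvect_sum wedge_suml.
  by apply: eq_bigr => j _; rewrite wedgeZl entry mxE.
rewrite exchange_big; apply: eq_bigr => j _ /=.
rewrite lcontr_bvecs wedge_sumr; apply: eq_bigr => i _.
by rewrite wedgeZr entry.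
Qed.

End Extended.

(** * Directional derivatives of matrix and multivector fields *)

Section Derivatives.
Context {R : realType} {n : nat} {M : topologicalType} {phi : chart R n M}.
Context {U : chart_open phi}.
Implicit Types (f : U -> R) (p : U) (u : vec R n).

Lemma smooth_derivable f i p : smooth f ->
  derivable (coord_expr f) (phi (val p)) (delta_mx 0 i).
Proof. by move=> fs; have [_ /(_ i) []] := fs 1%N. Qed.

Definition deriv_at u f p : R := \sum_i u i 0 * partial i f p.

Lemma eq_deriv_at u f f' p : f =1 f' -> deriv_at u f p = deriv_at u f' p.
Proof. by move=> /funext ->. Qed.

Lemma deriv_at_cst u (c : R) p : deriv_at u (fun=> c) p = 0.
Proof.
rewrite /deriv_at big1 // => i _; apply/eqP; rewrite mulf_eq0; apply/orP; right.
have nc := @coord_expr_near _ _ _ _ U (fun=> c) (cst c) p (fun=> erefl).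
by rewrite /partial (near_eq_derive _ nc) derive_cst.
Qed.

Lemma deriv_atD u f f' p : smooth f -> smooth f' ->
  deriv_at u (fun q => f q + f' q) p = deriv_at u f p + deriv_at u f' p.
Proof.
move=> fs fs'; rewrite -big_split; apply: eq_bigr => i _ /=.
rewrite -mulrDr /partial coord_exprD deriveD //; exact: smooth_derivable.
Qed.

Lemma deriv_atM u f f' p : smooth f -> smooth f' ->
  deriv_at u (fun q => f q * f' q) p
    = deriv_at u f p * f' p + f p * deriv_at u f' p.
Proof.
move=> fs fs'; rewrite mulr_suml mulr_sumr -big_split; apply: eq_bigr => i _ /=.
rewrite partialM; try exact: smooth_derivable.
rewrite mulrDr [LHS]addrC; congr (_ + _); last first.
  exact: GRing.mulrCA.
by rewrite mulrA mulrAC.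
Qed.

Lemma deriv_at_sum u (I : Type) (r : seq I) (P : pred I) (F : I -> U -> R) p :
  (forall i, P i -> smooth (F i)) ->
  deriv_at u (fun q => \sum_(i <- r | P i) F i q) p
    = \sum_(i <- r | P i) deriv_at u (F i) p.
Proof.
move=> Fs; elim: r => [|i r IH].
  rewrite big_nil (@eq_deriv_at _ _ (fun=> 0)) ?deriv_at_cst // => q.
  by rewrite big_nil.
rewrite big_cons; case: ifP => Pi; last first.
  by rewrite -IH; apply: eq_deriv_at => q; rewrite big_cons Pi.
rewrite -IH -deriv_atD; [|exact: Fs|exact: smooth_sum].
by apply: eq_deriv_at => q; rewrite big_cons Pi.
Qed.

Definition mx_smooth (m k : nat) (t : U -> 'M[R]_(m, k)) : Prop :=
  forall i j, smooth (fun q => t q i j).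

Definition mx_deriv (m k : nat) u (t : U -> 'M[R]_(m, k)) p : 'M[R]_(m, k) :=
  \matrix_(i, j) deriv_at u (fun q => t q i j) p.

Lemma mx_deriv_cst (m k : nat) u (A : 'M[R]_(m, k)) p :
  mx_deriv u (fun=> A) p = 0.
Proof. by apply/matrixP => i j; rewrite !mxE deriv_at_cst. Qed.

Lemma mx_derivM (m k l : nat) u (s : U -> 'M[R]_(m, k)) (t : U -> 'M[R]_(k, l)) p :
  mx_smooth s -> mx_smooth t ->
  mx_deriv u (fun q => s q *m t q) p
    = mx_deriv u s p *m t p + s p *m mx_deriv u t p.
Proof.
move=> ss ts; apply/matrixP => i j; rewrite !mxE.
under [X in deriv_at u X]eq_fun do rewrite mxE.
rewrite deriv_at_sum => [|a _]; last exact: smoothM.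
rewrite -big_split; apply: eq_bigr => a _ /=.
by rewrite deriv_atM // !mxE.
Qed.

Lemma mx_deriv_tr (m k : nat) u (t : U -> 'M[R]_(m, k)) p :
  mx_deriv u (fun q => (t q)^T) p = (mx_deriv u t p)^T.
Proof.
apply/matrixP => i j; rewrite !mxE; apply: eq_deriv_at => q.
by rewrite mxE.
Qed.

Definition mv_deriv u (F : U -> mvec R n) p : mvec R n :=
  [ffun S => deriv_at u (fun q => F q S) p].

Lemma mv_deriv_cst u (X : mvec R n) p : mv_deriv u (fun=> X) p = 0.
Proof. by apply/ffunP => S; rewrite !ffunE deriv_at_cst. Qed.

Lemma mv_derivZ u f (F : U -> mvec R n) p : smooth f -> msmooth F ->
  mv_deriv u (fun q => f q *: F q) p
    = deriv_at u f p *: F p + f p *: mv_deriv u F p.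
Proof.
move=> fs Fs; apply/ffunP => S; rewrite !ffunE.
rewrite -[RHS]deriv_atM //; apply: eq_deriv_at => q.
by rewrite ffunE.
Qed.

Lemma mv_deriv_sum u (I : Type) (r : seq I) (F : I -> U -> mvec R n) p :
  (forall i, msmooth (F i)) ->
  mv_deriv u (fun q => \sum_(i <- r) F i q) p
    = \sum_(i <- r) mv_deriv u (F i) p.
Proof.
move=> Fs; apply/ffunP => S; rewrite sum_ffunE ffunE.
under [X in deriv_at u X]eq_fun do rewrite sum_ffunE.
rewrite deriv_at_sum => [|i _]; last exact: Fs.
by apply: eq_bigr => i _; rewrite ffunE.
Qed.

Lemma mv_deriv_wedge u (F G : U -> mvec R n) p : msmooth F -> msmooth G ->
  mv_deriv u (fun q => wedge (F q) (G q)) p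
    = wedge (mv_deriv u F p) (G p) + wedge (F p) (mv_deriv u G p).
Proof.
move=> Fs Gs; apply/ffunP => S; rewrite !ffunE.
under [X in deriv_at u X]eq_fun do rewrite ffunE.
rewrite deriv_at_sum => [|A _]; last first.
  by apply: smoothM; [exact: smooth_cst|exact: smoothM].
rewrite -big_split; apply: eq_bigr => A _ /=.
rewrite deriv_atM; [|exact: smooth_cst|exact: smoothM].
by rewrite deriv_at_cst mul0r add0r deriv_atM // !ffunE mulrDr.
Qed.

Lemma mv_deriv_mvect u (w : U -> vec R n) p : mx_smooth w ->
  mv_deriv u (fun q => mvect (w q)) p = mvect (mx_deriv u w p).
Proof.
move=> ws; rewrite mv_deriv_sum => [|i]; last first.
  by apply: msmoothZ; [exact: ws|exact: msmooth_cst].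
apply: eq_bigr => i _; rewrite mv_derivZ; [|exact: ws|exact: msmooth_cst].
by rewrite mv_deriv_cst scaler0 addr0 mxE.
Qed.

(** On a wedge of constant vectors, the derivative of t(v_1) /\ ... /\ t(v_k)
replaces one factor t(v_i) at a time by t(s v_i), which is the extended of t
applied to the generalized of s. *)
Lemma mv_deriv_extended u (t : U -> 'M[R]_n) (F : U -> mvec R n) s p :
  mx_smooth t -> msmooth F -> mx_deriv u t p = t p *m s ->
  mv_deriv u (fun q => extended_of (mulmx (t q)) (F q)) p
    = extended_of (mulmx (t p))
        (mv_deriv u F p + generalized_of (mulmx s) (F p)).
Proof.
move=> ts Fs dt.
have tv v : mx_smooth (fun q => t q *m v).
  by apply: smooth_mulmx => // i j; apply: smooth_cst.
have ws r : msmooth (fun q => wedges [seq t q *m v | v <- r]).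
  elim: r => [|v r IH] /=; first exact: msmooth_cst.
  by apply: msmooth_wedge => //; apply: msmooth_mvect => i; exact: tv.
have dw r : mv_deriv u (fun q => wedges [seq t q *m v | v <- r]) p
    = extended_of (mulmx (t p)) (generalized_of (mulmx s) (wedges r)).
  elim: r => [|v r IH].
    by rewrite mv_deriv_cst generalized_mscal linear0.
  rewrite /= mv_deriv_wedge //; last by apply: msmooth_mvect => i; exact: tv.
  rewrite IH mv_deriv_mvect // mx_derivM //; last by move=> ? ?; exact: smooth_cst.
  rewrite mx_deriv_cst mulmx0 addr0 dt generalized_wedge linearD /=.
  rewrite !extended_wedge extended_wedges.
  by rewrite /= mulmxA.
rewrite {1}/extended_of mv_deriv_sum => [|S]; last first.
  apply: msmoothZ; first exact: Fs.
  have := ws [seq bvec i | i <- enum S].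
  by under [X in msmooth X]eq_fun do rewrite -map_comp.
rewrite linearD /= [extended_of _ (mv_deriv _ _ _)]/extended_of.
have /= -> := linear_mvec_blades
  (extended_of (mulmx (t p)) \o generalized_of (mulmx s)) (F p).
rewrite -big_split /=; apply: eq_bigr => S _.
under [X in mv_deriv u X]eq_fun do rewrite (map_comp (mulmx _) bvec).
by rewrite mv_derivZ // dw ffunE bladeE -map_comp.
Qed.

(** The change of connection under a change of frame: the inhomogeneous term
t d(t^-1) comes from differentiating the extended of t^-1. *)
Lemma conjugate_derivation u (t t' : U -> 'M[R]_n) A (F : U -> mvec R n) p :
  mx_smooth t' -> msmooth F -> t p *m t' p = 1%:M ->
  extended_of (mulmx (t p))
    (mv_deriv u (fun q => extended_of (mulmx (t' q)) (F q)) p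
     + generalized_of (mulmx A) (extended_of (mulmx (t' p)) (F p)))
  = mv_deriv u F p
    + generalized_of (mulmx (t p *m A *m t' p + t p *m mx_deriv u t' p)) (F p).
Proof.
move=> ts' Fs tt'; have t't := mulmx1C tt'.
rewrite (@mv_deriv_extended _ _ _ (t p *m mx_deriv u t' p)) //; last first.
  by rewrite mulmxA t't mul1mx.
rewrite linearD /= (extended_generalized _ _ t't) !(extendedK tt').
by rewrite -addrA generalizedD (addrC (generalized_of (mulmx (_ *m _ *m _)) _)).
Qed.

End Derivatives.

(** * Transport of operator pairs *)

Section Transport.
Context {R : realType} {n : nat} {M : topologicalType} {phi : chart R n M}.
Context {U : chart_open phi}.
Implicit Types (p : U) (u : vec R n) (a b : vfield U) (X : mvfield U).
Implicit Types (k h : extfield U) (D : operator_pair U).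

Lemma mx_deriv_bvecs (m l : nat) u (t : U -> 'M[R]_(m, l)) p :
  mx_deriv u t p = \sum_i u i 0 *: mx_deriv (bvec i) t p.
Proof.
apply/matrixP => r s; rewrite summxE mxE; apply: eq_bigr => i _.
rewrite !mxE; congr (_ * _).
rewrite /deriv_at (bigD1 i) //= big1 ?addr0 => [|j ji]; rewrite mxE.
  by rewrite !eqxx mul1r.
by rewrite (negPf ji) mul0r.
Qed.

Lemma mx_smooth_deriv (m l : nat) u (t : U -> 'M[R]_(m, l)) :
  mx_smooth t -> mx_smooth (mx_deriv u t).
Proof.
move=> ts i j.
apply: (@smooth_ext _ _ _ _ _ _ (deriv_at u (fun q => t q i j))) => [p|].
  by rewrite mxE.
by apply: smooth_sum => l' _; apply: smoothM;
  [exact: smooth_cst|exact: smooth_partial].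
Qed.

Lemma mvfield_eq X (Y : mvfield U) : (forall p, X p = Y p) -> X = Y.
Proof.
case: X Y => [F Fs] [G Gs] /= /funext FG; move: Fs Gs; rewrite FG => Fs Gs.
by congr MVField; apply: Prop_irrelevance.
Qed.

Lemma vector_connection_bilinear (C : 'I_n -> U -> 'M[R]_n) p :
  bilinear_for *:%R *:%R
    (fun u v : vec R n => (\sum_i u i 0 *: C i p) *m v).
Proof.
split=> [v c u u'|u c v v'] /=; last by rewrite mulmxDr scalemxAr.
rewrite scalemxAl -mulmxDl scaler_sumr -big_split /=; congr (_ *m _).
by apply: eq_bigr => i _; rewrite !mxE scalerDl scalerA.
Qed.

(** The matrices C i of the connection in the directions b_i determine it, and
in this form both operators are derivative plus generalized of a matrix, so
that the same conjugation identity serves for both. *)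
Lemma is_dcdo_pairP D : is_dcdo_pair D <->
  exists2 C : 'I_n -> U -> 'M[R]_n, forall i, mx_smooth (C i) &
    forall a X p, let A := \sum_i a p i 0 *: C i p in
      D.1 a X p = mv_deriv (a p) X p + generalized_of (mulmx A) (X p) /\
      D.2 a X p = mv_deriv (a p) X p + generalized_of (mulmx (- A^T)) (X p).
Proof.
split=> [[gamma gD]|[C Cs CD]].
  pose C i p := \matrix_(k, j) gamma p (bvec i) (bvec j) k 0.
  exists C => [i k j|a X p A].
    apply: smooth_ext (conn_smooth gamma i j k) => p.
    by rewrite mxE.
  have gA : generalized_of (gamma p (a p)) = generalized_of (mulmx A).
    apply/funext; apply: eq_generalized => j; apply/colP => k.
    have lin c u u' := (conn_bilinear gamma p).1 (bvec j) c u u'.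
    pose L := GRing.isLinear.Build _ _ _ _ (gamma p ^~ (bvec j)) lin.
    pose f : {linear vec R n -> vec R n} := HB.pack (gamma p ^~ (bvec j)) L.
    rewrite [in LHS](vec_sum (a p)) -[LHS]/(f _ k 0) linear_sum -colE.
    rewrite [RHS]mxE !summxE; apply: eq_bigr => i _.
    by rewrite linearZ !mxE.
  have [-> ->] := gD a X p.
  by rewrite gA madjoint_generalized generalizedN.
have gs i j r : smooth (fun p => ((\sum_l (bvec i : vec R n) l 0 *: C l p)
    *m (bvec j : vec R n)) r 0).
  apply: (@smooth_ext _ _ _ _ _ _ (fun p => C i p r j)) => [p|]; last exact: Cs.
  rewrite (bigD1 i) //= big1 => [|l li]; last by rewrite mxE (negPf li) scale0r.
  by rewrite addr0 -colE !mxE !eqxx mul1r.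
exists (Connection (vector_connection_bilinear C) gs) => a X p.
have [-> ->] := CD a X p; split=> //=.
by rewrite madjoint_generalized generalizedN.
Qed.

Lemma ext_inv_smooth h (hu : nonsingular h) : mx_smooth (fun p => invmx (h p)).
Proof. exact: smooth_invmx hu (extfield_smooth h). Qed.

Definition ext_inv h (hu : nonsingular h) : extfield U :=
  ExtField (ext_inv_smooth hu).

Lemma ext_inv_nonsingular h (hu : nonsingular h) : nonsingular (ext_inv hu).
Proof. by move=> p; rewrite unitmx_inv. Qed.

Lemma ext_tr_smooth h : mx_smooth (fun p => (h p)^T).
Proof.
move=> i j; apply: smooth_ext (extfield_smooth h j i) => p.
by rewrite mxE.
Qed.

Definition ext_tr h : extfield U := ExtField (ext_tr_smooth h).

Lemma ext_extendedK h (h' : extfield U) :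
  (forall p, h p *m h' p = 1%:M) -> cancel (ext_extended h') (ext_extended h).
Proof. by move=> hh' X; apply: mvfield_eq => p; apply: extendedK. Qed.

Lemma star_trK h (hu : nonsingular h) p : ext_star hu p *m ext_tr h p = 1%:M.
Proof. by rewrite /= -trmx_mul mulmxV ?trmx1. Qed.

Lemma tr_starK h (hu : nonsingular h) p : ext_tr h p *m ext_star hu p = 1%:M.
Proof. exact: mulmx1C (star_trK hu p). Qed.

(** The minus operator is conjugated by h*, whose inverse is h^T. *)
Definition transport h (hu : nonsingular h) D : operator_pair U :=
  (fun a X => ext_extended h (D.1 a (ext_extended (ext_inv hu) X)),
   fun a X => ext_extended (ext_star hu) (D.2 a (ext_extended (ext_tr h) X))).

Lemma gauge_relatedE h (hu : nonsingular h) D D' :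
  gauge_related hu D D' <-> D' = transport hu D.
Proof.
split=> [hDD'|-> a X /=]; last first.
  by rewrite !ext_extendedK // => p; [rewrite tr_starK|rewrite mulVmx].
case: D' hDD' => D1 D2 hDD'.
congr pair; apply/funext => a; apply/funext => X.
  have [-> _] := hDD' a (ext_extended (ext_inv hu) X).
  by rewrite ext_extendedK // => p; rewrite mulmxV.
have [_ ->] := hDD' a (ext_extended (ext_tr h) X).
by rewrite ext_extendedK // => p; rewrite star_trK.
Qed.

Lemma transportK h h' (hu : nonsingular h) (hu' : nonsingular h') :
  (forall p, h' p *m h p = 1%:M) -> cancel (transport hu) (transport hu').
Proof.
move=> h'h [D1 D2]; have hh' p := mulmx1C (h'h p).
have hV p : invmx (h p) = h' p by rewrite -[LHS]mul1mx -(h'h p) mulmxK.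
have h'V p : invmx (h' p) = h p by rewrite -[LHS]mul1mx -(hh' p) mulmxK.
congr pair; apply/funext => a; apply/funext => X; rewrite /= !ext_extendedK //.
- by move=> p /=; rewrite hV h'V.
- by move=> p /=; rewrite -trmx_mul h'h trmx1.
- by move=> p /=; rewrite -trmx_mul hV h'V h'h trmx1.
Qed.

Lemma transport_dcdo h (hu : nonsingular h) D :
  is_dcdo_pair D -> is_dcdo_pair (transport hu D).
Proof.
case/is_dcdo_pairP => C Cs CD; apply/is_dcdo_pairP.
have hs : mx_smooth h := @extfield_smooth _ _ _ _ _ h.
have Vs := ext_inv_smooth hu.
pose V p := invmx (h p).
exists (fun i p => h p *m C i p *m V p + h p *m mx_deriv (bvec i) V p).
  move=> i j l; apply: (@smooth_ext _ _ _ _ _ _ (fun p =>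
    (h p *m C i p *m V p) j l + (h p *m mx_deriv (bvec i) V p) j l)) => [p|].
    by rewrite mxE.
  apply: smoothD; apply: smooth_mulmx => //; last exact: mx_smooth_deriv.
  exact: smooth_mulmx hs (Cs i).
move=> a X p A; pose B := \sum_i a p i 0 *: C i p.
have hV q : h q *m V q = 1%:M by rewrite mulmxV.
have AE : A = h p *m B *m V p + h p *m mx_deriv (a p) V p.
  rewrite mx_deriv_bvecs mulmx_sumr mulmx_suml mulmx_sumr -big_split /=.
  by apply: eq_bigr => i _; rewrite scalerDr -!scalemxAr -!scalemxAl.
have Xs := mvfield_smooth X.
split.
  have [/= -> _] := CD a (ext_extended (ext_inv hu) X) p.
  by rewrite -/B AE; apply: conjugate_derivation.
have [_ /= ->] := CD a (ext_extended (ext_tr h) X) p.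
have -> := @conjugate_derivation _ _ _ _ _ (a p) (ext_star hu) (ext_tr h)
  (- B^T) X p (@ext_tr_smooth h) Xs (star_trK hu p).
congr (_ + generalized_of (mulmx _) _).
(* Differentiating h h^-1 = 1 trades the derivative of h^T for that of h^-1. *)
have : mx_deriv (a p) (fun q => h q *m V q) p = 0.
  by rewrite (funext hV) mx_deriv_cst.
rewrite mx_derivM // => /eqP; rewrite addrC addr_eq0 => /eqP dV.
rewrite AE dV mx_deriv_tr -!trmx_mul linearB /= opprB addrC.
by rewrite mulmxN mulNmx -!trmx_mul mulmxA.
Qed.

(** Compatibility of D is used on the vector field c = h^-1 b, for which
h^T k' b = k c.  The plus operator maps vector fields to vector fields, so
its grade 1 coordinates lose nothing. *)
Lemma transport_compatible h (hu : nonsingular h) k k' D :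
  (forall p, k p = (h p)^T *m k' p *m h p) -> is_dcdo_pair D ->
  compatible k D -> compatible k' (transport hu D).
Proof.
move=> kE /is_dcdo_pairP[C Cs CD] kD a b p.
pose c := ext_apply (ext_inv hu) b.
have hc q : h q *m c q = b q by rewrite mulmxA mulmxV // mul1mx.
have D2E : ext_extended (ext_tr h) (mvect_field (ext_apply k' b))
    = mvect_field (ext_apply k c).
  apply: mvfield_eq => q /=.
  by rewrite extended_mvect kE -!mulmxA hc.
have D1E : ext_extended (ext_inv hu) (mvect_field b) = mvect_field c.
  by apply: mvfield_eq => q /=; rewrite extended_mvect.
have [w Dw] : exists w, D.1 a (mvect_field c) p = mvect w.
  have [-> _] := CD a (mvect_field c) p.
  rewrite /= mv_deriv_mvect; last first.
    by move=> i j; rewrite ord1; exact: (vfield_smooth c).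
  by rewrite generalized_mvect -mvectD; eexists.
have /eqP := kD a c p.
rewrite /ext_covderiv subr_eq0 Dw vpart_mvect => /eqP D2w.
rewrite /ext_covderiv /= D2E D1E D2w Dw !extended_mvect vpart_mvect.
apply/eqP; rewrite subr_eq0; apply/eqP; congr mvect.
have := star_trK hu p; rewrite /= => st.
by rewrite kE !mulmxA st mul1mx.
Qed.

End Transport.

Theorem theorem2 (R : realType) (n : nat) (M : topologicalType)
    (atlas : set (chart R n M)) (hM : smooth_manifold atlas)
    (phi : chart R n M) (hphi : atlas phi) (U : chart_open phi)
    (g eta h : extfield U) (hg : metric_field g)
    (hh : gauge_metric_field g eta h) :
  (forall D : operator_pair U, is_dcdo_pair D -> compatible g D ->
     exists! D' : operator_pair U,
       [/\ is_dcdo_pair D', compatible eta D'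
         & gauge_related (gauge_nonsingular hh) D D']) /\
  (forall D' : operator_pair U, is_dcdo_pair D' -> compatible eta D' ->
     exists! D : operator_pair U,
       [/\ is_dcdo_pair D, compatible g D
         & gauge_related (gauge_nonsingular hh) D D']).
Proof.
set hu := gauge_nonsingular hh; have gE := gauge_eq hh.
split=> [D dD cD|D' dD' cD'].
  exists (transport hu D); split.
    split; [exact: transport_dcdo|exact: transport_compatible gE dD cD|].
    exact/gauge_relatedE.
  by move=> D' [_ _ /gauge_relatedE].
have hVu := ext_inv_nonsingular hu.
exists (transport hVu D'); split.
  split; first exact: transport_dcdo.
    apply: transport_compatible dD' cD' => p /=.
    by rewrite gE !mulmxA -trmx_mul mulmxK // mulmxV // trmx1 mul1mx.
  by apply/gauge_relatedE; rewrite transportK // => p; rewrite /= mulmxV.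
move=> D [_ _ /gauge_relatedE ->].
by rewrite transportK // => p; rewrite /= mulVmx.
Qed.
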